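(* Let $X$ be a normal Hausdorff topological space, $\Phi$ a local semiflow on $X$, and $\mathscr{A}$ an attractor of $\Phi$. Suppose $\mathscr{A}$ has an admissible neighborhood $N_1$. Then any attractor $A$ of $\Phi$ in $\mathscr{A}$ (i.e. any attractor of the restricted global semiflow $\Phi|_{\mathscr{A}}$ on $\mathscr{A}$) is also an attractor of $\Phi$ in $X$.
   Context: Setting: $X$ is a normal Hausdorff topological space and $\Phi$ is a local semiflow on $X$ (a continuous map from an open set $\mathcal{D}_\Phi\subset\mathbb{R}^+\times X$ to $X$, with escape times $T_x\in(0,\infty]$, $\Phi(0)x=x$, and $\Phi(t+s)x=\Phi(t)\Phi(s)x$). A set $U$ is a neighborhood of $A$ if $\overline{A}\subset\operatorname{int}U$. A set $M$ attracts $B$ if $T_x=\infty$ for all $x\in B$ and for every neighborhood $V$ of $M$ there is $t_0>0$ with $\Phi(t)B\subset V$ for all $t>t_0$. A set is sequentially compact (s-compact) if every sequence in it has a subsequence converging to a point of the set. An attractor of $\Phi$ is a nonempty s-compact invariant set $\mathscr{A}$ for which there is a neighborhood $N$ of $\mathscr{A}$ such that $\mathscr{A}$ attracts $N$ and $\mathscr{A}$ is the maximal s-compact invariant set in $N$. Since $\mathscr{A}$ is invariant, the restriction $\Phi|_{\mathscr{A}}$ is a global semiflow on $\mathscr{A}$; a set $A\subset\mathscr{A}$ is called an attractor of $\Phi$ in $\mathscr{A}$ if it is an attractor of $\Phi|_{\mathscr{A}}$ (with $\mathscr{A}$ carrying the subspace topology). A set $M$ is admissible if for any sequences $x_n\in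 M$ and $t_n\to\infty$ with $\Phi([0,t_n])x_n\subset M$ for all $n$, the sequence $\Phi(t_n)x_n$ has a convergent subsequence. *)

(* Defs.v *)
From HB Require Import structures.
From mathcomp Require Import all_boot all_order all_algebra.
From mathcomp Require Import all_classical all_reals all_analysis.
Set Implicit Arguments. Unset Strict Implicit. Unset Printing Implicit Defensive.
Import Order.TTheory GRing.Theory Num.Theory numFieldNormedType.Exports.
Local Open Scope classical_set_scope.
Local Open Scope ring_scope.

Section semiflows.
Context {R : realType} {X : topologicalType}.

(* A local semiflow is given by a (total) function Phi : R -> X -> X together
   with escape times T : X -> \bar R; its domain is
   D_Phi = {(t,x) | 0 <= t < T x} ; outside D_Phi, Phi is irrelevant. *)
Definition sf_dom (T : X -> \bar R) : set (R * X) :=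
  [set p | 0 <= p.1 /\ (p.1%:E < T p.2)%E].

Definition local_semiflow (Phi : R -> X -> X) (T : X -> \bar R) : Prop :=
  [/\ (forall x, (0 < T x)%E),
      (exists O : set (R * X), open O /\ sf_dom T = [set p | 0 <= p.1] `&` O),
      {within sf_dom T, continuous (fun p => Phi p.1 p.2)},
      (forall x, Phi 0 x = x) &
      (forall x t s, 0 <= t -> 0 <= s -> ((t + s)%:E < T x)%E ->
          (t%:E < T (Phi s x))%E /\ Phi (t + s) x = Phi t (Phi s x))].

Definition nbhd_of (A U : set X) : Prop := closure A `<=` U°.

Definition s_compact (M : set X) : Prop :=
  forall u : nat -> X, (forall n, M (u n)) ->
    exists (phi : nat -> nat) (x : X),
      {homo phi : m n / (m < n)%N >-> (m < n)%N} /\ M x /\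
      (u \o phi) @ \oo --> x.

Definition invariant (Phi : R -> X -> X) (T : X -> \bar R) (M : set X) :=
  (forall x, M x -> T x = +oo%E) /\ (forall t, 0 <= t -> Phi t @` M = M).

Definition attracts (Phi : R -> X -> X) (T : X -> \bar R) (M B : set X) :=
  (forall x, B x -> T x = +oo%E) /\
  (forall V, nbhd_of M V ->
     exists t0, 0 < t0 /\ forall t, t0 < t -> Phi t @` B `<=` V).

Definition attractor (Phi : R -> X -> X) (T : X -> \bar R) (A : set X) :=
  [/\ A !=set0, s_compact A, invariant Phi T A &
      exists N, [/\ nbhd_of A N, attracts Phi T A N &
        forall B, B `<=` N -> s_compact B -> invariant Phi T B -> B `<=` A]].

Definition admissible (Phi : R -> X -> X) (T : X -> \bar R) (M : set X) :=
  forall (x : nat -> X) (t : nat -> R),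
    (forall n, M (x n)) -> t @ \oo --> +oo ->
    (forall n s, 0 <= s <= t n -> (s%:E < T (x n))%E /\ M (Phi s (x n))) ->
    exists (phi : nat -> nat) (y : X),
      {homo phi : m n / (m < n)%N >-> (m < n)%N} /\
      (fun n => Phi (t (phi n)) (x (phi n))) @ \oo --> y.

End semiflows.

(* Restriction of Phi to a set Acal, as a semiflow on the subspace
   [set_type Acal] (sigma type with the subspace = initial topology).
   The value is only meaningful when Acal is invariant and t >= 0. *)
Definition restr_sf {R : realType} {X : topologicalType} (Phi : R -> X -> X)
  (Acal : set X) : R -> set_type Acal -> set_type Acal :=
  fun t y => insubd y (Phi t (set_val y)).

Definition restr_T {R : realType} {X : topologicalType} (T : X -> \bar R)
  (Acal : set X) : set_type Acal -> \bar R := fun y => T (set_val y).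
Arguments restr_sf {R X} Phi Acal _ _.
Arguments restr_T {R X} T Acal _.

(* Main.v *)
Require Import Defs.
From HB Require Import structures.
From mathcomp Require Import all_boot all_order all_algebra.
From mathcomp Require Import all_classical all_reals all_analysis.
From mathcomp Require Import lra.
Set Implicit Arguments.
Unset Strict Implicit.
Unset Printing Implicit Defensive.
Import Order.TTheory GRing.Theory Num.Theory numFieldNormedType.Exports.
Local Open Scope classical_set_scope.
Local Open Scope ring_scope.

(** Write K for the given attractor of the whole semiflow and let N be a
   neighborhood that it attracts. Admissibility makes every sequence
   Phi t_n x_n with x_n in N and t_n -> +oo subconvergent. The limits of such
   sequences form a sequentially compact invariant set, so by maximality they
   lie in K. Let A be an attractor in K, attracting the trace on K of an open
   set Q.

   The sets A and K need not be closed, so closure A may leave Q. But the limits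
   along orbits starting in closure A lie in closure A `&` K, hence in Q, so
   Phi s maps closure A into Q for some s, and N `&` Phi s @^-1` Q is a
   neighborhood of A whose trace on K is attracted by A.

   By normality shrink it to W. A limit of Phi t_n x_n along orbit segments that
   stay in W up to time t_n - 1 is Phi r z with z in K `&` closure W and r as
   large as we wish, so it is interior to any given neighborhood V of A. Hence
   an orbit that has stayed in W for a long enough time t is in V at time t + 1.
   Taking V = W, orbits that stay long enough in W stay there forever; taking V
   arbitrary, A attracts them. *)

Lemma cvg_strictly_increasing (phi : nat -> nat) :
  {homo phi : m n / (m < n)%N >-> (m < n)%N} -> phi @ \oo --> \oo.
Proof.
move=> /leq_mono/unstable.mono_leq_infl phi_ge; apply/cvgnyPge => m.
by exists m => // n /= mn; exact: leq_trans (phi_ge n).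
Qed.

Section neighborhoods_of_sets.
Context {X : topologicalType}.

Lemma nbhd_of_subl (A B U : set X) : A `<=` B -> nbhd_of B U -> nbhd_of A U.
Proof. by move=> AB; apply: subset_trans; exact: closure_subset. Qed.

Lemma nbhd_of_closure_sub (A U : set X) : nbhd_of A U -> closure A `<=` U.
Proof. by move=> AU; apply: subset_trans AU _; exact: interior_subset. Qed.

Lemma normal_nbhd_of (A U : set X) : normal_space X -> nbhd_of A U ->
  exists2 W, nbhd_of A W & closure W `<=` U.
Proof. by move=> nX AU; exact: (nX _ (@closed_closure _ A)). Qed.

End neighborhoods_of_sets.

Section local_semiflows.
Context {R : realType} {X : topologicalType}.
Variables (Phi : R -> X -> X) (T : X -> \bar R).

Definition global_on (B : set X) := forall x, B x -> T x = +oo%E.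

Definition positively_invariant (B : set X) :=
  forall t, 0 <= t -> Phi t @` B `<=` B.

Lemma invariant_positively_invariant (B : set X) :
  Defs.invariant Phi T B -> positively_invariant B.
Proof. by move=> [_ invB] t /invB ->. Qed.

Lemma attracts_sub (A B C : set X) :
  C `<=` B -> attracts Phi T A B -> attracts Phi T A C.
Proof.
move=> CB [TB attrAB]; split=> [x /CB/TB //|V /attrAB[t0 [t0_gt0 inV]]].
exists t0; split=> // t /inV; apply: subset_trans; exact: image_subset.
Qed.

Hypothesis sfPhi : local_semiflow Phi T.

Lemma semiflow0 x : Phi 0 x = x.
Proof. by case: sfPhi. Qed.

Lemma semiflowD x t s : T x = +oo%E -> 0 <= t -> 0 <= s ->
  Phi (t + s) x = Phi t (Phi s x).
Proof.
case: sfPhi => _ _ _ _ cocycle Tx t_ge0 s_ge0.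
by case: (cocycle x t s t_ge0 s_ge0); rewrite ?Tx ?ltry.
Qed.

Lemma semiflowB x t s : T x = +oo%E -> 0 <= s <= t ->
  Phi t x = Phi (t - s) (Phi s x).
Proof.
by move=> Tx /andP[s_ge0 st]; rewrite -semiflowD ?subr_ge0// subrK.
Qed.

Lemma escape_time_gt x t s : T x = +oo%E -> 0 <= t -> 0 <= s ->
  (t%:E < T (Phi s x))%E.
Proof.
case: sfPhi => _ _ _ _ cocycle Tx t_ge0 s_ge0.
by case: (cocycle x t s t_ge0 s_ge0); rewrite ?Tx ?ltry.
Qed.

Lemma semiflow_near x t V : T x = +oo%E -> 0 <= t -> nbhs (Phi t x) V ->
  \forall p \near (t, x), 0 <= p.1 -> V (Phi p.1 p.2).
Proof.
case: sfPhi => _ [D [oD domE]] /subspace_continuousP cPhi _ _ Tx t_ge0 nV.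
have dom_tx : sf_dom T (t, x) by split; rewrite //= Tx ltry.
have nD : nbhs (t, x) D.
  by apply: open_nbhs_nbhs; split=> //; move: dom_tx; rewrite domE => -[].
have := cPhi _ dom_tx _ nV; rewrite /nbhs/= /within => nPhiV.
by apply: filterS2 nD nPhiV => p Dp + p_ge0; apply; rewrite domE.
Qed.

Lemma semiflow_continuous x t : T x = +oo%E -> 0 <= t ->
  Phi t y @[y --> x] --> Phi t x.
Proof.
move=> Tx t_ge0 V /(semiflow_near Tx t_ge0)[[A B] /= [nA nB] ABV].
apply: filterS nB => y By; apply: (ABV (t, y)) => //; split=> //.
exact: nbhs_singleton.
Qed.

Lemma positively_invariant_closure (B : set X) : global_on (closure B) ->
  positively_invariant B -> positively_invariant (closure B).
Proof.
move=> TB posB t t_ge0 _ [x clBx <-] V.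
move=> /(semiflow_continuous (TB _ clBx) t_ge0)/clBx[b [Bb Vb]].
by exists (Phi t b); split=> //; apply: (posB t t_ge0); exists b.
Qed.

Lemma attracts_preimage (A B C : set X) (s : R) : global_on C -> 0 <= s ->
  Phi s @` C `<=` B -> attracts Phi T A B -> attracts Phi T A C.
Proof.
move=> TC s_ge0 CB [_ attrAB]; split=> // V /attrAB[t0 [t0_gt0 inV]].
exists (s + t0); split=> [|t st _ [x Cx <-]]; first lra.
rewrite (@semiflowB x t s) ?TC//; last by apply/andP; split; lra.
apply: (inV (t - s)); first lra.
by exists (Phi s x) => //; apply: CB; exists x.
Qed.

Definition trapped (W : set X) (t : R) : set X :=
  [set x | forall s, 0 <= s <= t -> W (Phi s x)].

Lemma trapped_le (W : set X) (t t' : R) :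
  t <= t' -> trapped W t' `<=` trapped W t.
Proof.
by move=> tt' x Wx s /andP[s_ge0 st]; apply: Wx; rewrite s_ge0 (le_trans st).
Qed.

Lemma trapped_sub (W : set X) (t : R) : 0 <= t -> trapped W t `<=` W.
Proof. by move=> t_ge0 x /(_ 0); rewrite lexx semiflow0; apply. Qed.

Lemma trapped_forever (W : set X) (t0 : R) : 0 <= t0 ->
  (forall t x, t0 <= t -> trapped W t x -> W (Phi (t + 1) x)) ->
  forall t, trapped W (t0 + 1) `<=` trapped W t.
Proof.
move=> t0_ge0 extend t x Wx.
suff trapped_n n : trapped W (t0 + 1 + n%:R) x.
  apply: trapped_le (trapped_n (Num.truncn t).+1).
  have := truncnS_gt t; lra.
elim: n => [|n IHn]; first by rewrite addr0.
move=> s /andP[s_ge0]; rewrite -natr1 => s_le.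
have n_ge0 : 0 <= n%:R :> R by [].
have [sn|ns] := leP s (t0 + 1 + n%:R); first by apply: IHn; rewrite s_ge0.
rewrite -(subrK 1 s); apply: extend; first lra.
apply: trapped_le IHn; lra.
Qed.

Lemma trapped_near x b (W : set X) : T x = +oo%E ->
  (forall t, 0 <= t <= b -> nbhs (Phi t x) W) -> nbhs x (trapped W b).
Proof.
move=> Tx nW; have /compact_near_coveringP cover := @segment_compact R 0 b.
have : \forall y \near x, `[0, b] `<=` (fun s => 0 <= s -> W (Phi s y)).
  apply: (cover _ (nbhs x) (fun y s => 0 <= s -> W (Phi s y))) => t /=.
  rewrite in_itv/= => tb; have /andP[t_ge0 _] := tb.
  exact: semiflow_near Tx t_ge0 (nW t tb).
apply: filterS => y Wy t tb; apply: Wy; last by case/andP: tb.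
by rewrite /= in_itv.
Qed.

Lemma trapped_nbhd_of (A W : set X) (b : R) : global_on (closure A) ->
  positively_invariant A -> nbhd_of A W -> nbhd_of A (trapped W b).
Proof.
move=> TA posA AW c clAc; apply: trapped_near (TA _ clAc) _ => t /andP[t_ge0 _].
by apply: AW; apply: (positively_invariant_closure TA posA t_ge0); exists c.
Qed.

End local_semiflows.

Section omega_limits.
Context {R : realType} {X : topologicalType}.
Variables (Phi : R -> X -> X) (T : X -> \bar R).

Definition asymptotically_compact (B : set X) :=
  forall (x : nat -> X) (t : nat -> R),
    (forall n, B (x n)) -> t @ \oo --> +oo ->
    exists (phi : nat -> nat) (y : X),
      {homo phi : m n / (m < n)%N >-> (m < n)%N} /\
      (fun n => Phi (t (phi n)) (x (phi n))) @ \oo --> y.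

(* Restricting the pairs (time, initial point), and not only the initial
   points, makes it possible to take limits along orbit segments. *)
Definition omega_limit_along (S : set (R * X)) : set X :=
  [set y | exists (x : nat -> X) (t : nat -> R),
    [/\ forall n, S (t n, x n), t @ \oo --> +oo &
        (fun n => Phi (t n) (x n)) @ \oo --> y]].

Definition omega_limit (B : set X) := omega_limit_along (snd @^-1` B).

Lemma omega_limit_along_subset (S S' : set (R * X)) :
  S `<=` S' -> omega_limit_along S `<=` omega_limit_along S'.
Proof. by move=> SS' y [x [t [Sx]]]; exists x, t; split=> // n; exact: SS'. Qed.

Lemma omega_limit_along_closed (S : set (R * X)) (F : set X) (t0 : R) :
  closed F -> (forall t x, t0 <= t -> S (t, x) -> F (Phi t x)) ->
  omega_limit_along S `<=` F.
Proof.
move=> clF SF y [x [t [Sx /cvgryPge ty xy]]].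
by apply: (closed_cvg F clF _ _ xy); apply: filterS (ty t0) => n /SF; apply.
Qed.

Lemma invariant_sub_omega_limit (B : set X) :
  Defs.invariant Phi T B -> B `<=` omega_limit B.
Proof.
move=> [_ invB] y By.
have /choice[x xB] : forall n, exists x, B x /\ Phi n%:R x = y.
  by move=> n; move: By; rewrite -{1}(invB n%:R)// => -[x]; exists x.
exists x, (fun n => n%:R); split; [by move=> n; case: (xB n)|exact: cvgr_idn|].
have -> : (fun n => Phi n%:R (x n)) = fun=> y.
  by apply/funext => n; case: (xB n).
exact: cvg_cst.
Qed.

Section asymptotically_compact_set.
Variable B : set X.
Hypothesis acB : asymptotically_compact B.

Lemma asymptotically_compact_omega_limit_along (S : set (R * X))
    (x : nat -> X) (t : nat -> R) :
  S `<=` snd @^-1` B -> (forall n, S (t n, x n)) -> t @ \oo --> +oo ->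
  exists (phi : nat -> nat) (y : X),
    [/\ {homo phi : m n / (m < n)%N >-> (m < n)%N}, omega_limit_along S y &
        (fun n => Phi (t (phi n)) (x (phi n))) @ \oo --> y].
Proof.
move=> SB Sx ty; have [|phi [y [phi_incr cvy]]] := acB (x := x) _ ty.
  by move=> n; exact: SB (Sx n).
exists phi, y; split=> //; exists (x \o phi), (t \o phi); split=> //.
- by move=> n; exact: Sx.
- exact: cvg_comp (cvg_strictly_increasing phi_incr) ty.
Qed.

Lemma omega_limit_along_eventually (S : set (R * X)) (V : set X) :
  S `<=` snd @^-1` B -> omega_limit_along S `<=` V° ->
  exists2 t0, 0 <= t0 & forall t x, t0 <= t -> S (t, x) -> V (Phi t x).
Proof.
move=> SB omegaV; apply: contrapT => noV.
have /choice[p pP] : forall n : nat, exists p : R * X,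
    [/\ n%:R <= p.1, S p & ~ V (Phi p.1 p.2)].
  move=> n; apply: contrapT => /forallNP nop; apply: noV; exists n%:R => //.
  by move=> t x tn Sx; apply: contrapT => nVx; apply: (nop (t, x)); split.
have [|||phi [y [_ yS cvy]]] := asymptotically_compact_omega_limit_along
    (x := fun n => (p n).2) (t := fun n => (p n).1) (S := S) => //.
- by move=> n; rewrite -surjective_pairing; case: (pP n).
- apply: ger_cvgy cvgr_idn; apply: nearW => n; by case: (pP n).
have [n _ /(_ n (leqnn n))/=] := cvy _ (omegaV _ yS).
by case: (pP (phi n)).
Qed.

Hypothesis hX : hausdorff_space X.
Hypothesis sfPhi : local_semiflow Phi T.
Hypothesis TB : global_on T B.
Hypothesis T_omega : global_on T (omega_limit B).

Lemma omega_limit_along_pull_back (S : set (R * X)) (s : R) (y : X) :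
  S `<=` snd @^-1` B -> 0 <= s -> omega_limit_along S y ->
  exists2 z, omega_limit_along [set p | S (p.1 + s, p.2)] z & Phi s z = y.
Proof.
move=> SB s_ge0 [x [t [Sx ty cvy]]].
have shiftB : [set p | S (p.1 + s, p.2)] `<=` snd @^-1` B by move=> p /SB.
have [||phi [z [phi_incr zS cvz]]] := asymptotically_compact_omega_limit_along
    (x := x) (t := fun n => t n - s) shiftB.
- by move=> n; rewrite /= subrK.
- exact: cvg_comp ty (cvg_addrr (- s)).
exists z => //.
have Tz : T z = +oo%E by apply: T_omega; exact: omega_limit_along_subset zS.
have phi_y := cvg_strictly_increasing phi_incr.
apply: (cvg_unique hX (F := (fun n => Phi (t (phi n)) (x (phi n))) @ \oo)).
  have := cvg_comp _ _ cvz (semiflow_continuous sfPhi Tz s_ge0).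
  apply: cvg_trans; apply: near_eq_cvg.
  have /cvgryPge/(_ s) : (t \o phi) @ \oo --> +oo by exact: cvg_comp phi_y ty.
  apply: filterS => n /= st; have Tx := TB (SB _ (Sx (phi n))).
  by rewrite -(semiflowD sfPhi) ?subr_ge0// addrC subrK.
exact: cvg_comp phi_y cvy.
Qed.

Lemma omega_limit_invariant : Defs.invariant Phi T (omega_limit B).
Proof.
split=> // s s_ge0; apply/seteqP; split=> [_ [y By <-]|y By].
  have Ty := T_omega By; case: By => x [t [Bx ty cvy]].
  exists x, (fun n => s + t n); split=> //.
    exact: cvg_comp ty (cvg_addrl s).
  have := cvg_comp _ _ cvy (semiflow_continuous sfPhi Ty s_ge0).
  apply: cvg_trans; apply: near_eq_cvg.
  move/cvgryPge : ty => /(_ 0); apply: filterS => n tn /=.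
  by rewrite (semiflowD sfPhi)// (TB (Bx n)).
by have [//|z Bz <-] := omega_limit_along_pull_back _ s_ge0 By; exists z.
Qed.

(* Invariance lets y_n be written as Phi n z_n, so that asymptotic compactness
   applies to the sequence y itself: no diagonal argument, hence no first
   countability, is needed. *)
Lemma omega_limit_s_compact : omega_limit B `<=` B -> s_compact (omega_limit B).
Proof.
move=> omegaB y yB.
have /choice[z zB] : forall n, exists z, omega_limit B z /\ Phi n%:R z = y n.
  move=> n; have := yB n; have [_ invB] := omega_limit_invariant.
  by rewrite -{1}(invB n%:R)// => -[z]; exists z.
have [|||phi [w [phi_incr wB cvw]]] := asymptotically_compact_omega_limit_along
    (x := z) (t := fun n => n%:R) (S := snd @^-1` B) => //.
- by move=> n; apply: omegaB; case: (zB n).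
- exact: cvgr_idn.
exists phi, w; split=> //; split=> //.
apply: cvg_trans cvw; apply: near_eq_cvg; apply: nearW => n /=.
by case: (zB (phi n)).
Qed.

End asymptotically_compact_set.
End omega_limits.

Section attracted_sets.
Context {R : realType} {X : topologicalType}.
Variables (Phi : R -> X -> X) (T : X -> \bar R) (K B : set X).
Hypothesis sfPhi : local_semiflow Phi T.
Hypothesis attrKB : attracts Phi T K B.

Lemma attracts_omega_limit_sub_closure : hausdorff_space X -> normal_space X ->
  omega_limit Phi B `<=` closure K.
Proof.
move=> hX nX y yB; apply: contrapT => nKy.
have : nbhd_of K (~` [set y]).
  move=> x Kx; apply: open_nbhs_nbhs; split; last by move: Kx => /[swap] ->.
  exact/closed_openC/accessible_closed_set1/hausdorff_accessible.
move=> /(normal_nbhd_of nX)[W KW clW]; apply: (clW y) => //.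
have [_ /(_ _ KW)[t0 [_ inW]]] := attrKB.
apply: (omega_limit_along_closed (@closed_closure _ W) (t0 := t0 + 1)) yB.
move=> t x tt Bx; apply/subset_closure/(inW t); [lra|by exists x].
Qed.

Lemma attracts_asymptotically_compact (M : set X) :
  nbhd_of K M -> admissible Phi T M -> asymptotically_compact Phi B.
Proof.
move=> KM admM x t Bx ty; have [TB /(_ _ KM)[t0 [t0_gt0 inM]]] := attrKB.
pose s := t0 + 1; have s_ge0 : 0 <= s by rewrite /s; lra.
have x_in_M n r : s <= r -> M (Phi r (x n)).
  by move=> sr; apply: (inM r); [rewrite /s in sr; lra|exists (x n)].
have [||n r /andP[r_ge0 rn]|phi [y [phi_incr cvy]]] :=
    admM (fun n => Phi s (x n)) (fun n => t n - s).
- by move=> n; exact: x_in_M.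
- exact: cvg_comp ty (cvg_addrr (- s)).
- split; first by apply: (escape_time_gt sfPhi) => //; exact: TB.
  by rewrite -(semiflowD sfPhi) ?TB//; apply: x_in_M; lra.
exists phi, y; split=> //; apply: cvg_trans cvy; apply: near_eq_cvg.
have /cvgryPge/(_ s) : (t \o phi) @ \oo --> +oo.
  exact: cvg_comp (cvg_strictly_increasing phi_incr) ty.
by apply: filterS => n /= sn; rewrite -(semiflowB sfPhi) ?TB// s_ge0.
Qed.

End attracted_sets.

Lemma attractor_asymptotically_compact_nbhd {R : realType} {X : topologicalType}
    (Phi : R -> X -> X) (T : X -> \bar R) (K M : set X) :
  hausdorff_space X -> normal_space X -> local_semiflow Phi T ->
  attractor Phi T K -> nbhd_of K M -> admissible Phi T M ->
  exists N, [/\ nbhd_of K N, global_on T N, asymptotically_compact Phi N &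
                omega_limit Phi N `<=` K].
Proof.
move=> hX nX sfPhi [_ _ _ [N [KN attrKN maxK]]] KM admM.
have [TN _] := attrKN.
have acN := attracts_asymptotically_compact sfPhi attrKN KM admM.
have omegaN : omega_limit Phi N `<=` N.
  move=> y /(attracts_omega_limit_sub_closure attrKN hX nX).
  exact: nbhd_of_closure_sub.
have T_omega : global_on T (omega_limit Phi N) by move=> y /omegaN/TN.
exists N; split=> //; apply: maxK => //.
- exact: (omega_limit_s_compact acN hX sfPhi TN T_omega).
- exact: omega_limit_invariant.
Qed.

(* An attractor of the semiflow restricted to K, expressed in the ambient
   space: its neighborhood in K is the trace on K of an open set Q. *)
Definition attractor_in {R : realType} {X : topologicalType}
    (Phi : R -> X -> X) (T : X -> \bar R) (K A : set X) :=
  [/\ A !=set0, s_compact A, Defs.invariant Phi T A, A `<=` K &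
      exists Q, [/\ open Q, closure A `&` K `<=` Q,
        attracts Phi T A (K `&` Q) &
        forall B, B `<=` K `&` Q -> s_compact B -> Defs.invariant Phi T B ->
          B `<=` A]].

Section ambient_attraction.
Context {R : realType} {X : topologicalType}.
Variables (Phi : R -> X -> X) (T : X -> \bar R) (K N : set X).
Hypotheses (hX : hausdorff_space X) (nX : normal_space X).
Hypothesis sfPhi : local_semiflow Phi T.
Hypothesis invK : Defs.invariant Phi T K.
Hypothesis TN : global_on T N.
Hypothesis acN : asymptotically_compact Phi N.
Hypothesis omegaNK : omega_limit Phi N `<=` K.

Let T_omega : global_on T (omega_limit Phi N).
Proof. by case: invK => TK _ y /omegaNK/TK. Qed.

Lemma closure_enters_open (A Q : set X) :
  closure A `<=` N -> positively_invariant Phi A ->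
  open Q -> closure A `&` K `<=` Q ->
  exists2 s, 0 <= s & Phi s @` closure A `<=` Q.
Proof.
move=> AN posA oQ AKQ.
have posC : positively_invariant Phi (closure A).
  by apply: (positively_invariant_closure sfPhi) => // x /AN/TN.
have [||s s_ge0 enterQ] := omega_limit_along_eventually acN
    (S := snd @^-1` closure A) (V := Q).
- by move=> p /AN.
- rewrite (interior_id _).1// => y yA; apply: AKQ; split.
    apply: (omega_limit_along_closed (@closed_closure _ A) (t0 := 0)) yA.
    by move=> t x t_ge0 Ax; apply: (posC t t_ge0); exists x.
  apply: omegaNK; apply: omega_limit_along_subset yA => p; exact: AN.
by exists s => // _ [c clAc <-]; exact: enterQ.
Qed.

(* The last unit of time is left free so that the case V = W propagates being
   trapped in W; see trapped_forever. *)
Lemma trapped_eventually (A W V : set X) :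
  W `<=` N -> attracts Phi T A (K `&` closure W) -> nbhd_of A V ->
  exists2 t0, 0 <= t0 &
    forall t x, t0 <= t -> trapped Phi W t x -> V (Phi (t + 1) x).
Proof.
move=> WN [_ attrA] AV.
pose S := [set p : R * X | 1 <= p.1 /\ trapped Phi W (p.1 - 1) p.2].
have SN : S `<=` snd @^-1` N.
  by move=> [t x] [/= t1 /(trapped_sub sfPhi)Wx]; apply/WN/Wx; rewrite subr_ge0.
have [|s [s_gt0 inV]] := attrA V°; first by move=> c /AV/nbhs_interior.
have omegaV : omega_limit_along Phi S `<=` V°.
  move=> y yS; have [||z zS <-] := omega_limit_along_pull_back acN hX sfPhi TN
    T_omega (S := S) (s := s + 1) _ _ yS => //; first lra.
  apply: (inV (s + 1)); first lra.
  exists z => //; split.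
    by apply: omegaNK; apply: omega_limit_along_subset zS => p /SN.
  apply: (omega_limit_along_closed (@closed_closure _ W) (t0 := 0)) zS.
  move=> t x t_ge0 [_ Wx]; apply: subset_closure; apply: Wx; rewrite /=.
  by apply/andP; split; lra.
have [t0 t0_ge0 SV] := omega_limit_along_eventually acN SN omegaV.
exists t0 => // t x tt Wx; apply: SV; first lra.
by split; rewrite /= ?addrK//; lra.
Qed.

Lemma attracts_nbhd_of (A Q : set X) :
  positively_invariant Phi A -> nbhd_of A Q -> Q `<=` N ->
  attracts Phi T A (K `&` Q) ->
  exists U, [/\ nbhd_of A U, U `<=` Q & attracts Phi T A U].
Proof.
move=> posA AQ QN attrQ; have [W AW clW] := normal_nbhd_of nX AQ.
have WQ : W `<=` Q by apply: subset_trans clW; exact: subset_closure.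
have WN := subset_trans WQ QN.
have TA : global_on T (closure A) by move=> x /(nbhd_of_closure_sub AQ)/QN/TN.
have attrW : attracts Phi T A (K `&` closure W).
  by apply: attracts_sub attrQ; exact: setIS.
have [t0 t0_ge0 stepW] := trapped_eventually WN attrW AW.
have UW : trapped Phi W (t0 + 1) `<=` W by apply: (trapped_sub sfPhi); lra.
exists (trapped Phi W (t0 + 1)); split.
- exact: (trapped_nbhd_of sfPhi).
- exact: subset_trans UW WQ.
split=> [x /UW/WN/TN //|V AV].
have [t1 t1_ge0 stepV] := trapped_eventually WN attrW AV.
exists (t1 + 1); split=> [|t tt _ [x Ux <-]]; first lra.
rewrite -(subrK 1 t); apply: stepV; first lra.
exact: trapped_forever Ux.
Qed.

Lemma attractor_of_attractor_in (A : set X) :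
  nbhd_of K N -> attractor_in Phi T K A -> attractor Phi T A.
Proof.
move=> KN [A0 cA invA AK [Q [oQ AKQ attrQ maxA]]].
have posA := invariant_positively_invariant invA.
have AN := nbhd_of_subl AK KN.
have clAN := nbhd_of_closure_sub AN.
have [s s_ge0 enterQ] := closure_enters_open clAN posA oQ AKQ.
pose Q' := N `&` Phi s @^-1` Q.
have AQ' : nbhd_of A Q'.
  move=> c clAc; apply: filterI; first exact: AN.
  apply: (semiflow_continuous sfPhi (TN (clAN _ clAc)) s_ge0).
  by apply: open_nbhs_nbhs; split=> //; apply: enterQ; exists c.
have attrQ' : attracts Phi T A (K `&` Q').
  apply: (attracts_preimage sfPhi _ s_ge0 _ attrQ) => [x [_ [/TN]]//|].
  move=> _ [x [Kx [_ Qx]] <-]; split=> //.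
  by apply: (invariant_positively_invariant invK s_ge0); exists x.
have Q'N : Q' `<=` N by move=> x [].
have [U [AU UQ' attrU]] := attracts_nbhd_of posA AQ' Q'N attrQ'.
split=> //; exists U; split=> // B BU cB invB.
have BQ' := subset_trans BU UQ'.
apply: maxA => // x Bx; split.
  apply: omegaNK; apply: omega_limit_along_subset.
    exact: preimage_subset (subset_trans BQ' Q'N).
  exact: invariant_sub_omega_limit invB _ Bx.
have [_ /(_ _ s_ge0) invBs] := invB.
by move: Bx; rewrite -{1}invBs => -[z /BQ'[_ Qz] <-].
Qed.

End ambient_attraction.

Section restriction.
Context {R : realType} {X : topologicalType}.
Variables (Phi : R -> X -> X) (T : X -> \bar R) (K : set X).

Lemma nbhs_set_val (y : set_type K) (V : set (set_type K)) :
  nbhs y V <-> exists2 U, nbhs (set_val y) U & set_val @^-1` U `<=` V.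
Proof.
split=> [[_ [[U oU <-] Uy UV]]|[U nU UV]].
  by exists U => //; exact: open_nbhs_nbhs.
by apply: filterS UV _; exact: (@initial_continuous _ _ (@set_val _ K)).
Qed.

Lemma closure_set_val (A : set (set_type K)) (y : set_type K) :
  closure A y <-> closure (set_val @` A) (set_val y).
Proof.
split=> [Ay U nU|Ay V /nbhs_set_val[U /Ay[_ [[a Aa <-] Ua]] UV]].
  have [|a [Aa Ua]] := Ay (set_val @^-1` U).
    by apply/nbhs_set_val; exists U.
  by exists (set_val a); split=> //; exists a.
by exists a; split=> //; exact: UV.
Qed.

Lemma cvg_set_val (F : set_system (set_type K)) {FF : Filter F}
    (y : set_type K) :
  set_val @ F --> set_val y <-> F --> y.
Proof.
split=> [Fy V /nbhs_set_val[U /Fy FU UV]|Fy U nU]; first exact: filterS UV FU.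
by apply: Fy; apply/nbhs_set_val; exists U.
Qed.

Lemma s_compact_set_val (A : set (set_type K)) :
  s_compact A <-> s_compact (set_val @` A).
Proof.
split=> cA u uA.
  have /choice[v vA] : forall n, exists v, A v /\ set_val v = u n.
    by move=> n; have [v] := uA n; exists v.
  have [|phi [x [phi_incr [Ax cvx]]]] := cA v; first by move=> n; case: (vA n).
  exists phi, (set_val x); split=> //; split; first by exists x.
  have -> : u = set_val \o v by apply/funext => n; case: (vA n).
  exact/(@cvg_set_val ((v \o phi) @ \oo)).
have [|phi [_ [phi_incr [[x Ax <-] cvx]]]] := cA (set_val \o u).
  by move=> n; exists (u n).
by exists phi, x; split=> //; split=> //; exact/cvg_set_val.
Qed.

Hypothesis invK : Defs.invariant Phi T K.

Lemma restr_sf_val t (y : set_type K) : 0 <= t ->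
  set_val (restr_sf Phi K t y) = Phi t (set_val y).
Proof.
move=> t_ge0; apply: insubdK; apply/mem_set.
apply: (invariant_positively_invariant invK t_ge0).
by exists (set_val y) => //; exact: set_valP.
Qed.

Lemma image_restr_sf t (A : set (set_type K)) : 0 <= t ->
  Phi t @` (set_val @` A) = set_val @` (restr_sf Phi K t @` A).
Proof.
move=> t_ge0; rewrite !image_comp.
by apply: eq_imagel => y _ /=; rewrite restr_sf_val.
Qed.

Lemma invariant_set_val (A : set (set_type K)) :
  Defs.invariant (restr_sf Phi K) (restr_T T K) A <->
  Defs.invariant Phi T (set_val @` A).
Proof.
split=> -[TA invA]; split.
- by move=> _ [y Ay <-]; exact: TA.
- by move=> t t_ge0; rewrite image_restr_sf// invA.
- by move=> y Ay; apply: TA; exists y.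
- move=> t t_ge0; apply/funext => y.
  by rewrite -[LHS](image_inj val_inj) -[RHS](image_inj val_inj)
     -image_restr_sf// invA.
Qed.

Lemma attracts_set_val (A B : set (set_type K)) :
  attracts (restr_sf Phi K) (restr_T T K) A B ->
  attracts Phi T (set_val @` A) (set_val @` B).
Proof.
move=> [TB attrB]; split=> [_ [y By <-]|V AV]; first exact: TB.
have [|t0 [t0_gt0 inV]] := attrB (set_val @^-1` V).
  by move=> y /closure_set_val/AV nV; apply/nbhs_set_val; exists V.
exists t0; split=> // t tt; rewrite image_restr_sf; last first.
  exact/ltW/(lt_trans t0_gt0).
by move=> _ [y /(inV _ tt) Vy <-].
Qed.

Lemma attractor_in_set_val (A : set (set_type K)) :
  attractor (restr_sf Phi K) (restr_T T K) A ->
  attractor_in Phi T K (set_val @` A).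
Proof.
move=> [A0 cA invA [N [AN attrN maxA]]].
have [Q oQ QN] : open (N° : set (set_type K)) by exact: open_interior.
have KQN : K `&` Q `<=` set_val @` N.
  move=> x [Kx Qx]; exists (SigSub (mem_set Kx)) => //.
  by apply: (@interior_subset _ N); rewrite -QN.
split; [exact: image_nonempty|exact/s_compact_set_val|
        exact/invariant_set_val|by move=> _ [y _ <-]; exact: set_valP|].
exists Q; split=> //.
- move=> x [clAx Kx]; have := AN (SigSub (mem_set Kx)).
  by rewrite -QN; apply; exact/closure_set_val.
- exact: attracts_sub KQN (attracts_set_val attrN).
move=> B BKQ cB invB.
have valB : set_val @` (set_val @^-1` B : set (set_type K)) = B.
  apply/seteqP; split=> [|x Bx]; first exact: image_preimage_subset.
  by have [Kx _] := BKQ _ Bx; exists (SigSub (mem_set Kx)).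
rewrite -valB; apply: image_subset; apply: maxA.
- by move=> y /BKQ/KQN[z Nz /val_inj <-].
- by apply/s_compact_set_val; rewrite valB.
- by apply/invariant_set_val; rewrite valB.
Qed.

End restriction.

Theorem theorem6p1 (R : realType) (X : topologicalType)
  (Phi : R -> X -> X) (T : X -> \bar R) (Acal N1 : set X) :
  hausdorff_space X -> normal_space X ->
  local_semiflow Phi T ->
  attractor Phi T Acal ->
  nbhd_of Acal N1 -> admissible Phi T N1 ->
  forall A : set (set_type Acal),
    attractor (restr_sf Phi Acal) (restr_T T Acal) A ->
    attractor Phi T (set_val @` A).
Proof.
move=> hX nX sfPhi attrK KN1 admN1 A attrA.
have [N [KN TN acN omegaNK]] :=
  attractor_asymptotically_compact_nbhd hX nX sfPhi attrK KN1 admN1.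
have [_ _ invK _] := attrK.
apply: (attractor_of_attractor_in hX nX sfPhi invK TN acN omegaNK KN).
exact: attractor_in_set_val.
Qed.
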